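(* Consider the game Circular Nim $\mathrm{CN}(7,4)$ (defined in the context). A position $\mathbf p$ is a $\mathcal P$-position if and only if $\mathbf p\in S=S_1\cup S_2\cup S_3\cup S_4$, where, writing $\mathbf p=(a,b,c,d,e,f,g)$ in a representation with $a=\min(\mathbf p)$, - $S_1=\{\mathbf p \mid a=b=0,\ c=g>0,\ d+e+f=c\}$, - $S_2=\{\mathbf p \mid \mathbf p=(a,a,a,a,a,a,a)\}$, - $S_3=\{\mathbf p \mid a=b,\ c=g,\ d=f,\ a+c=d+e,\ 0<a<e\}$, - $S_4=\{\mathbf p \mid a=f,\ b+c=d+e=g+a,\ a<\min\{b,e\},\ a<\max\{c,d\}\}$.
   Context: Circular Nim $\mathrm{CN}(n,k)$: $n$ stacks of tokens are arranged in a circle; a position is a vector $\mathbf p=(p_1,\dots,p_n)$ of nonnegative integers giving the stack heights in order around the circle. A move consists of choosing $k$ cyclically consecutive stacks and removing at least one token from at least one of these $k$ stacks (any number of tokens may be removed from each of the chosen stacks, and stacks not chosen are unchanged). Under normal play, the last player able to move wins. A position is only determined up to rotation and reflection (reading the circle in either direction). A $\mathcal P$-position is one from which the player about to move loses under optimal play (the previous player wins); an $\mathcal N$-position is one from which the player about to move wins. A position $\mathbf p$ of $\mathrm{CN}(7,4)$ belongs to one of the sets $S_i$ if some rotation and/or reflection $(a,b,c,d,e,f,g)$ of $\mathbf p$ with $a=\min(\mathbf p)$ satisfies the listed conditions. *)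

(* Defs.v *)
From mathcomp Require Import all_boot.
Set Implicit Arguments. Unset Strict Implicit. Unset Printing Implicit Defensive.

(* Circular Nim CN(7,4). A position is a function 'I_7 -> nat giving
   the stack heights in cyclic order. *)
Definition position := 'I_7 -> nat.

Definition in_window (i j : 'I_7) : bool := ((j + 7 - i) %% 7 < 4)%N.

Definition move (p q : position) : Prop :=
  exists i : 'I_7,
    (forall j, ~~ in_window i j -> q j = p j) /\
    (forall j, (q j <= p j)%N) /\
    (exists j, (q j < p j)%N).

(* P-positions (previous player wins) and N-positions (next player wins)
   under normal play; every play terminates since moves decrease the total. *)
Inductive Ppos (p : position) : Prop :=
  | Ppos_intro : (forall q, move p q -> Npos q) -> Ppos p
with Npos (p : position) : Prop :=
  | Npos_intro : forall q, move p q -> Ppos q -> Npos p.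

Definition sym_read (p : position) (r : 'I_7) (refl : bool) (k : nat) : nat :=
  p (inord ((if refl then r + 7 - k %% 7 else r + k) %% 7)).

Definition S1 (a b c d e f g : nat) : Prop :=
  a = 0 /\ b = 0 /\ c = g /\ (0 < c)%N /\ d + e + f = c.
Definition S2 (a b c d e f g : nat) : Prop :=
  b = a /\ c = a /\ d = a /\ e = a /\ f = a /\ g = a.
Definition S3 (a b c d e f g : nat) : Prop :=
  a = b /\ c = g /\ d = f /\ a + c = d + e /\ (0 < a)%N /\ (a < e)%N.
Definition S4 (a b c d e f g : nat) : Prop :=
  a = f /\ b + c = d + e /\ d + e = g + a /\ (a < minn b e)%N /\ (a < maxn c d)%N.

Definition inS (p : position) : Prop :=
  exists (r : 'I_7) (refl : bool),
    let x := sym_read p r refl in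
    (forall j, (x 0 <= p j)%N) /\
    (S1 (x 0) (x 1) (x 2) (x 3) (x 4) (x 5) (x 6) \/
     S2 (x 0) (x 1) (x 2) (x 3) (x 4) (x 5) (x 6) \/
     S3 (x 0) (x 1) (x 2) (x 3) (x 4) (x 5) (x 6) \/
     S4 (x 0) (x 1) (x 2) (x 3) (x 4) (x 5) (x 6)).

(* Main.v *)
Require Import Defs.
From mathcomp Require Import all_boot.
From mathcomp Require Import zify.
Set Implicit Arguments. Unset Strict Implicit. Unset Printing Implicit Defensive.

(* It is enough that no move joins two positions of S and that every position
   outside S has a move into S. The first claim is linear arithmetic, one system
   for each choice of window, rotations and types of the two positions.

   For the second claim, rotate so that p = (M, b, c, d, e, f, g) with M the
   largest stack, and reflect so that c + d <= e + f. If c + d <= M, keep c, d, e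
   (or b, c, d) and move into S with minimum 0. If c + d > M and d, e < M, lower
   both neighbours of M to m = c + d - M and f to c + d - e; when a neighbour is
   already below m it becomes the minimum, and the move lowers the other
   neighbour and the three stacks next to that one. What remains are the positions
   with two maximal stacks at distance three, which are settled by comparing the
   two stacks and the three stacks that separate them. *)

(** * The set S as a condition on seven-tuples, up to symmetry *)

Definition canonical (a b c d e f g : nat) : Prop :=
  (a <= b /\ a <= c /\ a <= d /\ a <= e /\ a <= f /\ a <= g) /\
  (S1 a b c d e f g \/ S2 a b c d e f g \/ S3 a b c d e f g \/ S4 a b c d e f g).

(* Rotations suffice: each S_i is invariant under a reflection of the circle. *)
Definition in_S (a b c d e f g : nat) : Prop :=
  canonical a b c d e f g \/ canonical b c d e f g a \/
  canonical c d e f g a b \/ canonical d e f g a b c \/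
  canonical e f g a b c d \/ canonical f g a b c d e \/
  canonical g a b c d e f.

Lemma in_S_rot a b c d e f g : in_S b c d e f g a -> in_S a b c d e f g.
Proof. rewrite /in_S; tauto. Qed.

(** [S1] and [S3] are symmetric under the reflection that exchanges [a] with [b] and fixes [e]; [S4]
    is symmetric under the one that exchanges [a] with [f] and fixes [g]. *)
Lemma canonical_refl a b c d e f g :
  canonical a b c d e f g -> in_S a g f e d c b.
Proof.
move=> [Hmin [HS|[HS|[HS|HS]]]].
- right; right; right; right; right; right.
  by split; [|left]; move: HS; rewrite /S1; lia.
- left.
  by split; [|right; left]; move: HS; rewrite /S2; lia.
- right; right; right; right; right; right.
  by split; [|right; right; left]; move: HS; rewrite /S3; lia.
- right; right; left.
  by split; [|right; right; right]; move: HS; rewrite /S4; lia.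
Qed.

Lemma in_S_refl a b c d e f g : in_S a g f e d c b -> in_S a b c d e f g.
Proof.
case=> [|[|[|[|[|[|]]]]]] /canonical_refl; rewrite /in_S; tauto.
Qed.

(** * No move joins two positions of S *)

(* A window of four stacks is encoded by the three stacks outside of it. *)
Definition kept (a b c d e f g a' b' c' d' e' f' g' : nat) : Prop :=
  (a' = a /\ b' = b /\ c' = c) \/ (b' = b /\ c' = c /\ d' = d) \/
  (c' = c /\ d' = d /\ e' = e) \/ (d' = d /\ e' = e /\ f' = f) \/
  (e' = e /\ f' = f /\ g' = g) \/ (f' = f /\ g' = g /\ a' = a) \/
  (g' = g /\ a' = a /\ b' = b).

Definition below (a b c d e f g a' b' c' d' e' f' g' : nat) : Prop :=
  a' <= a /\ b' <= b /\ c' <= c /\ d' <= d /\ e' <= e /\ f' <= f /\ g' <= g.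

(** A comparison of sums excludes every genuine move, which lowers the total, and still admits the
    identity. *)
Lemma canonical_isolated a b c d e f g a' b' c' d' e' f' g' :
  canonical a b c d e f g -> in_S a' b' c' d' e' f' g' ->
  kept a b c d e f g a' b' c' d' e' f' g' ->
  below a b c d e f g a' b' c' d' e' f' g' ->
  a + b + c + d + e + f + g <= a' + b' + c' + d' + e' + f' + g'.
Proof.
rewrite /in_S /canonical /kept /below /S1 /S2 /S3 /S4.
move=> [? Sp] Sq ? ?.
case: Sq => [[? Sq]|[[? Sq]|[[? Sq]|[[? Sq]|[[? Sq]|[[? Sq]|[? Sq]]]]]]];
  by case: Sp => [?|[?|[?|?]]]; case: Sq => [?|[?|[?|?]]]; lia.
Qed.

Lemma in_S_isolated a b c d e f g a' b' c' d' e' f' g' :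
  in_S a b c d e f g -> in_S a' b' c' d' e' f' g' ->
  kept a b c d e f g a' b' c' d' e' f' g' ->
  below a b c d e f g a' b' c' d' e' f' g' ->
  a + b + c + d + e + f + g <= a' + b' + c' + d' + e' + f' + g'.
Proof.
move=> Sp Sq K B.
(* Used forwards, [in_S_rot] brings the last stack to the front, so six uses bring the first stack
   to the end. *)
have Sq1 := Sq; do 6! move/in_S_rot in Sq1.
have Sq2 := Sq1; do 6! move/in_S_rot in Sq2.
have Sq3 := Sq2; do 6! move/in_S_rot in Sq3.
have Sq4 := Sq3; do 6! move/in_S_rot in Sq4.
have Sq5 := Sq4; do 6! move/in_S_rot in Sq5.
have Sq6 := Sq5; do 6! move/in_S_rot in Sq6.
rewrite /kept in K; rewrite /below in B.
case: Sp => [Sp|[Sp|[Sp|[Sp|[Sp|[Sp|Sp]]]]]];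
  [ have := canonical_isolated Sp Sq | have := canonical_isolated Sp Sq1
  | have := canonical_isolated Sp Sq2 | have := canonical_isolated Sp Sq3
  | have := canonical_isolated Sp Sq4 | have := canonical_isolated Sp Sq5
  | have := canonical_isolated Sp Sq6 ];
  rewrite /kept /below => le_sum;
  (have {}le_sum := le_sum ltac:(tauto) ltac:(tauto));
  move: le_sum; clear; lia.
Qed.

(** * Families of target positions in S *)

Lemma in_S_const a : in_S a a a a a a a.
Proof. by left; split; rewrite /S2; lia. Qed.

(** For [c = 0] all stacks are empty and the position lies in [S2]. *)
Lemma in_S1 c d e f : d + e + f = c -> in_S 0 0 c d e f c.
Proof. by move=> E; left; split; rewrite /S1 /S2; lia. Qed.

Lemma in_S4 m b c d e g : b + c = g + m -> d + e = g + m ->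
  m < b -> m < e -> m <= c -> m <= d -> m < c \/ m < d -> in_S m b c d e m g.
Proof. by move=> *; left; split; [|right; right; right; rewrite /S4]; lia. Qed.

(* With minimum 0 the strict inequalities of S4 are not needed: the degenerate
   cases belong to S1 or S2. *)
Lemma in_S4_zero b c d e g : b + c = g -> d + e = g -> in_S 0 b c d e 0 g.
Proof.
move=> bc de; have [b0|b_gt0] := posnP b.
  have -> : g = c by lia.
  by rewrite b0; apply: in_S1; lia.
have [e0|e_gt0] := posnP e.
  have -> : d = g by lia.
  by rewrite e0; do 4! apply: in_S_rot; apply: in_S1; lia.
have [c0|c_gt0] := posnP c; last by apply: in_S4; lia.
have [d0|d_gt0] := posnP d; last by apply: in_S4; lia.
have [-> ->] : b = g /\ e = g by lia.
by rewrite c0 d0; do 2! apply: in_S_rot; apply: in_S1; lia.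
Qed.

Lemma in_S3 m c d e : m + c = d + e -> 0 < m -> m < e -> m <= d ->
  in_S m m c d e d c.
Proof. by move=> *; left; split; [|right; right; left; rewrite /S3]; lia. Qed.

(** * Every position is in S or has a move into S *)

(** Lowering nothing is allowed, so a position of S reaches itself and the case analysis need not
    ask about membership. *)
Definition reach_S (a b c d e f g : nat) : Prop :=
  exists a' b' c' d' e' f' g', [/\ in_S a' b' c' d' e' f' g',
    kept a b c d e f g a' b' c' d' e' f' g' &
    below a b c d e f g a' b' c' d' e' f' g'].

Lemma reach_rot a b c d e f g : reach_S b c d e f g a -> reach_S a b c d e f g.
Proof.
move=> [b' [c' [d' [e' [f' [g' [a' [Sq K B]]]]]]]].
exists a', b', c', d', e', f', g'; split; first exact: in_S_rot.
  by move: K; rewrite /kept; tauto.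
by move: B; rewrite /below; tauto.
Qed.

Lemma reach_refl a b c d e f g : reach_S a g f e d c b -> reach_S a b c d e f g.
Proof.
move=> [a' [g' [f' [e' [d' [c' [b' [Sq K B]]]]]]]].
exists a', b', c', d', e', f', g'; split; first exact: in_S_refl.
  by move: K; rewrite /kept; tauto.
by move: B; rewrite /below; tauto.
Qed.

Lemma reach_of_in_S a' b' c' d' e' f' g' a b c d e f g :
  in_S a' b' c' d' e' f' g' -> kept a b c d e f g a' b' c' d' e' f' g' ->
  below a b c d e f g a' b' c' d' e' f' g' -> reach_S a b c d e f g.
Proof. by exists a', b', c', d', e', f', g'. Qed.

Lemma reach_small_pair M b c d e f g :
  b <= M /\ c <= M /\ d <= M /\ e <= M /\ f <= M /\ g <= M ->
  c + d <= e + f -> c + d <= M -> reach_S M b c d e f g.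
Proof.
move=> ? cd_ef cd_M.
have [e_cd|cd_e] := leqP e (c + d).
  apply: reach_rot; apply: (reach_of_in_S
    (@in_S4_zero c d e (c + d - e) (c + d) _ _)); rewrite /kept /below; lia.
(* Now [c + d < e]: empty [f] and [g], and bring [M] and [e] to the smaller of [e] and [b + c + d],
   for a target in [S1]. *)
do 5! apply: reach_rot.
have [e_bcd|bcd_e] := leqP e (b + c + d).
  apply: (reach_of_in_S (@in_S1 e (e - c - d) c d _)); rewrite /kept /below; lia.
apply: (reach_of_in_S (@in_S1 (b + c + d) b c d _)); rewrite /kept /below; lia.
Qed.

Lemma reach_low_neighbour M b c d e f g :
  b <= M /\ c <= M /\ d <= M /\ e <= M /\ f <= M /\ g <= M ->
  b <= g -> M + b < c + d -> M + b < e + f ->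
  b.+1 < M \/ c < M \/ f < M -> reach_S M b c d e f g.
Proof.
move=> ? b_g cd ef bcf.
(* In the target, [e] and [d] become [M + b - f'] and [M + b - c]; [S4] wants one of them above [b],
   that is [f' < M] or [c < M]. If [c = f = M], then [f' = M - 1] works because [b + 1 < M]. *)
have [f' [f'_f b_f' ef' cf]] : exists f', [/\ f' <= f, b < f',
    M + b - f' <= e & c < M \/ f' < M].
  have [?|?] := ltnP c M; first by exists f; split; lia.
  have [?|?] := ltnP f M; first by exists f; split; lia.
  by exists M.-1; split; case: bcf; lia.
apply: reach_refl; apply: reach_rot.
by apply: (reach_of_in_S (@in_S4 b f' (M + b - f') (M + b - c) c M _ _ _ _ _ _ _));
  rewrite /kept /below; lia.
Qed.

Lemma reach_low_sum M b c d e f g :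
  b <= M /\ c <= M /\ d <= M /\ e <= M /\ f <= M /\ g <= M ->
  c + d <= M \/ e + f <= M -> reach_S M b c d e f g.
Proof.
move=> ? small.
have [?|?] := leqP (c + d) (e + f); first by apply: reach_small_pair; lia.
by apply: reach_refl; apply: reach_small_pair; lia.
Qed.

Lemma reach_strict_far M b c d e f g :
  b <= M /\ c <= M /\ d <= M /\ e <= M /\ f <= M /\ g <= M ->
  M < c + d -> c + d <= e + f -> d < M -> e < M ->
  reach_S M b c d e f g.
Proof.
move=> ? M_cd cd_ef d_M e_M.
have [b_low|b_high] := ltnP b (c + d - M).
  have [?|?] := leqP b g; first by apply: reach_low_neighbour; lia.
  by apply: reach_refl; apply: reach_low_neighbour; lia.
have [g_low|g_high] := ltnP g (c + d - M).
  by apply: reach_refl; apply: reach_low_neighbour; lia.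
apply: reach_rot.
(* If [d] and [e] both equal the new minimum, the condition of [S4] on the maximum fails; but then
   [c = f = M], and [d], [e] serve as the equal minimal pair of [S3]. *)
have [de|de] : (d = c + d - M /\ e = c + d - M) \/ (c + d - M < d \/ c + d - M < e).
  by lia.
  do 2! apply: reach_rot.
  apply: (reach_of_in_S (@in_S3 d M d M _ _ _ _)); rewrite /kept /below; lia.
apply: (reach_of_in_S (@in_S4 (c + d - M) c d e (c + d - e) M _ _ _ _ _ _ _));
  rewrite /kept /below; lia.
Qed.

(** If [M + b < f + minn e g], a target with minimum [b] is available; otherwise the target has
    minimum at most [b]. *)
Lemma reach_two_max_le M b c e f g :
  b <= c -> c <= M -> e <= M -> f <= M -> g <= M ->
  0 < b -> M < e + f -> M < f + g -> reach_S M b c M e f g.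
Proof.
move=> b_c c_M e_M f_M g_M b_gt0 M_ef M_fg.
have [high|low] := ltnP (M + b) (f + minn e g).
  have [bc|b_neq_c] := eqVneq b c.
    rewrite -bc; apply: reach_rot.
    by apply: (reach_of_in_S (@in_S3 b M (M + b - f) f _ _ _ _));
      rewrite /kept /below; lia.
  have [?|[cM fM bM eM gM]] : (b.+1 < M \/ c < M \/ f < M) \/
      [/\ c = M, f = M, b.+1 = M, e = M & g = M].
  - have [?|?] : (b.+1 < M \/ c < M \/ f < M) \/ (M <= b.+1 /\ M <= c /\ M <= f).
      by lia.
      by left.
    by right; split; lia.
  - by apply: reach_low_neighbour; lia.
  (* Only [b] differs from [M], by one; lowering three further stacks to [b] gives [S3]. *)
  do 3! apply: reach_rot.
  by apply: (reach_of_in_S (@in_S3 b M b M _ _ _ _)); rewrite /kept /below; lia.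
have [[? ?]|[[? ?]|[eM gM]]] :
  (g < M /\ g <= e) \/ (e < M /\ e <= g) \/ (e = M /\ g = M) by lia.
- apply: reach_rot.
  by apply: (reach_of_in_S (@in_S3 (f + g - M) M g f _ _ _ _));
    rewrite /kept /below; lia.
- apply: reach_rot.
  by apply: (reach_of_in_S (@in_S3 (f + e - M) M e f _ _ _ _));
    rewrite /kept /below; lia.
(* With [e = g = M] the case assumption reads [f <= b]. *)
have [cM|c_neq_M] := eqVneq c M.
  have [fM|f_neq_M] := eqVneq f M.
    by apply: (reach_of_in_S (in_S_const M)); rewrite /kept /below; lia.
  by apply: (reach_of_in_S (@in_S3 f M f M _ _ _ _)); rewrite /kept /below; lia.
have [?|?] := leqP (b + c) M.
  do 4! apply: reach_rot.
  by apply: (reach_of_in_S (@in_S1 M (M - b - c) b c _)); rewrite /kept /below; lia.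
have [?|?] := leqP (b + c) (M + f).
  do 4! apply: reach_rot.
  by apply: (reach_of_in_S (@in_S3 (b + c - M) M c b _ _ _ _));
    rewrite /kept /below; lia.
by apply: (reach_of_in_S (@in_S4 f b (M + f - b) f M M _ _ _ _ _ _ _));
  rewrite /kept /below; lia.
Qed.

Lemma reach_two_max M b c e f g :
  b <= M -> c <= M -> e <= M -> f <= M -> g <= M -> reach_S M b c M e f g.
Proof.
move=> b_M c_M e_M f_M g_M.
have [?|?] := leqP (e + f) M; first by apply: reach_low_sum; lia.
have [c0|c_gt0] := posnP c; first by apply: reach_low_sum; lia.
have [?|?] := leqP (f + g) M.
  by do 3! apply: reach_rot; apply: reach_low_sum; lia.
have [b0|b_gt0] := posnP b.
  by do 3! apply: reach_rot; apply: reach_low_sum; lia.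
have [?|?] := leqP b c; first by apply: reach_two_max_le; lia.
by do 3! apply: reach_rot; apply: reach_refl; apply: reach_two_max_le; lia.
Qed.

Lemma reach_max_first M b c d e f g :
  b <= M /\ c <= M /\ d <= M /\ e <= M /\ f <= M /\ g <= M ->
  reach_S M b c d e f g.
Proof.
move=> maxM.
have [dM|d_neq_M] := eqVneq d M; first by rewrite dM; apply: reach_two_max; lia.
have [eM|e_neq_M] := eqVneq e M.
  by rewrite eM; apply: reach_refl; apply: reach_two_max; lia.
have [?|?] := leqP (c + d) M; first by apply: reach_low_sum; lia.
have [?|?] := leqP (e + f) M; first by apply: reach_low_sum; lia.
have [?|?] := leqP (c + d) (e + f); first by apply: reach_strict_far; lia.
by apply: reach_refl; apply: reach_strict_far; lia.
Qed.

Lemma reach_total a b c d e f g : reach_S a b c d e f g.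
Proof.
have [m [le_m eq_m]] : exists m,
    (a <= m /\ b <= m /\ c <= m /\ d <= m /\ e <= m /\ f <= m /\ g <= m) /\
    (m = a \/ m = b \/ m = c \/ m = d \/ m = e \/ m = f \/ m = g).
  exists (maxn a (maxn b (maxn c (maxn d (maxn e (maxn f g)))))); split; first lia.
  by rewrite /maxn; do !case: ifP => _; tauto.
case: eq_m => [|[|[|[|[|[|]]]]]] m_eq; subst m;
  [ | do 1! apply: reach_rot | do 2! apply: reach_rot | do 3! apply: reach_rot
  | do 4! apply: reach_rot | do 5! apply: reach_rot | do 6! apply: reach_rot ];
  by apply: reach_max_first; tauto.
Qed.

(** * Translation between tuples and positions of the game *)

Notation stacks P p := (P (p (inord 0)) (p (inord 1)) (p (inord 2))
  (p (inord 3)) (p (inord 4)) (p (inord 5)) (p (inord 6))).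

Definition tokens (p : position) : nat :=
  stacks (fun a b c d e f g => a + b + c + d + e + f + g) p.

Lemma forall_ord7 (P : 'I_7 -> Prop) :
  P (inord 0) -> P (inord 1) -> P (inord 2) -> P (inord 3) -> P (inord 4) ->
  P (inord 5) -> P (inord 6) -> forall j, P j.
Proof.
move=> ? ? ? ? ? ? ? j; rewrite -(inord_val j).
by case: j => [[|[|[|[|[|[|[|//]]]]]]] ?].
Qed.

(* Left to unification, comparing unevaluated indices unfolds inord and does not
   end in reasonable time. *)
Ltac compute_inord :=
  repeat match goal with
  | |- context [inord ?k] =>
    progress (let k' := eval vm_compute in k in change k with k')
  end.

Lemma inS_in_S (p : position) : inS p -> stacks in_S p.
Proof.
move=> [r [refl [min_p HS]]].
set x := sym_read p r refl in min_p HS.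
have {min_p HS} : canonical (x 0) (x 1) (x 2) (x 3) (x 4) (x 5) (x 6).
  by split=> //; do ![split; first exact: min_p]; exact: min_p.
case: refl in x *.
  move/canonical_refl; rewrite {}/x.
  case: r => [[|[|[|[|[|[|[|//]]]]]]] ?]; rewrite /sym_read; compute_inord => can;
    [ | do 1! apply: in_S_rot | do 2! apply: in_S_rot | do 3! apply: in_S_rot
    | do 4! apply: in_S_rot | do 5! apply: in_S_rot | do 6! apply: in_S_rot ];
    exact: can.
rewrite {}/x.
case: r => [[|[|[|[|[|[|[|//]]]]]]] ?]; rewrite /sym_read; compute_inord => can;
  rewrite /in_S; tauto.
Qed.

Lemma in_S_inS (p : position) : stacks in_S p -> inS p.
Proof.
have inS_at r : let x := sym_read p (inord r) false in r < 7 ->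
    canonical (x 0) (x 1) (x 2) (x 3) (x 4) (x 5) (x 6) -> inS p.
  move=> x r_lt7 [min_p HS]; exists (inord r), false; split=> //.
  suff: forall j, x 0 <= p (inord ((r + j) %% 7)).
    (* Stack [j] is read at place [j - r] modulo 7; adding 7 first keeps the natural subtraction
       exact. *)
    move=> min_x j; have := min_x (j + 7 - r).
    have -> : (r + (j + 7 - r)) %% 7 = j by have := ltn_ord j; lia.
    by rewrite inord_val.
  move=> j.
  have -> : p (inord ((r + j) %% 7)) = x (j %% 7).
    by rewrite /x /sym_read inordK // modnDmr.
  have := ltn_pmod j (isT : 0 < 7).
  have := leqnn (x 0).
  case: (j %% 7) => [|[|[|[|[|[|[|//]]]]]]]; tauto.
case=> [|[|[|[|[|[|]]]]]] can;
 [ apply: (inS_at 0) | apply: (inS_at 1) | apply: (inS_at 2) | apply: (inS_at 3)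
  | apply: (inS_at 4) | apply: (inS_at 5) | apply: (inS_at 6) ];
  rewrite // /sym_read inordK //; compute_inord; exact: can.
Qed.

Lemma move_kept_below (p q : position) : move p q ->
  [/\ stacks (stacks kept p) q, stacks (stacks below p) q & tokens q < tokens p].
Proof.
move=> [i [outside [le_qp [j lt_qp]]]].
have below_qp : stacks (stacks below p) q by rewrite /below; do ![split=> //].
split=> //.
  have {}outside k : k < 7 -> ~~ ((k + 7 - i) %% 7 < 4) -> q (inord k) = p (inord k).
    by move=> k_lt7 k_out; apply: outside; rewrite /in_window inordK.
  rewrite /kept.
  (* The window starting at [i] leaves out the stacks [i + 4], [i + 5], [i + 6] modulo 7. *)
  case: i outside => [[|[|[|[|[|[|[|//]]]]]]] ?] outside;
    [ do 4! right | do 5! right | do 6! right | | right | do 2! right | do 3! right ];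
    try left; by do ![split]; apply: outside.
move: j lt_qp; apply: forall_ord7; move: below_qp; rewrite /below /tokens; lia.
Qed.

Lemma kept_below_move (p q : position) :
  stacks (stacks kept p) q -> stacks (stacks below p) q -> tokens q < tokens p ->
  move p q.
Proof.
move=> kept_qp below_qp lt_qp.
have le_qp : forall j, q j <= p j.
  by apply: forall_ord7; move: below_qp; rewrite /below; lia.
have some_lt : exists j, q j < p j.
  have := lt_qp; rewrite /tokens.
  have [? _|] := ltnP (q (inord 0)) (p (inord 0)); first by exists (inord 0).
  have [? _ _|] := ltnP (q (inord 1)) (p (inord 1)); first by exists (inord 1).
  have [? _ _ _|] := ltnP (q (inord 2)) (p (inord 2)); first by exists (inord 2).
  have [? _ _ _ _|] := ltnP (q (inord 3)) (p (inord 3)); first by exists (inord 3).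
  have [? _ _ _ _ _|] := ltnP (q (inord 4)) (p (inord 4)); first by exists (inord 4).
  have [? _ _ _ _ _ _|] := ltnP (q (inord 5)) (p (inord 5)); first by exists (inord 5).
  by exists (inord 6); lia.
have move_at i : i < 7 -> (forall j, ~~ in_window (inord i) j -> q j = p j) -> move p q.
  by move=> _ outside; exists (inord i).
case: kept_qp => [|[|[|[|[|[|]]]]]] [? [? ?]];
  [ apply: (move_at 3) | apply: (move_at 4) | apply: (move_at 5) | apply: (move_at 6)
  | apply: (move_at 0) | apply: (move_at 1) | apply: (move_at 2) ] => //;
  by apply: forall_ord7; rewrite /in_window !inordK.
Qed.

(** * S is the set of P-positions *)

Lemma inS_isolated (p q : position) : inS p -> inS q -> ~ move p q.
Proof.
move=> /inS_in_S Sp /inS_in_S Sq /move_kept_below [K B].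
by rewrite ltnNge (in_S_isolated Sp Sq K B).
Qed.

Lemma inS_or_move_inS (p : position) : inS p \/ exists2 q, move p q & inS q.
Proof.
have [a [b [c [d [e [f [g [Sq K B]]]]]]]] : stacks reach_S p by exact: reach_total.
pose q : position := fun j => nth 0 [:: a; b; c; d; e; f; g] j.
have qE k : k < 7 -> q (inord k) = nth 0 [:: a; b; c; d; e; f; g] k.
  by move=> k_lt7; rewrite /q inordK.
have [lt_qp|le_pq] := ltnP (a + b + c + d + e + f + g) (tokens p).
  right; exists q.
    by apply: kept_below_move; rewrite /tokens !qE.
  by apply: in_S_inS; rewrite !qE.
left; apply: in_S_inS; move: B le_pq; rewrite /below /tokens => B le_pq.
have [<- <- <- [<- [<- [<- <-]]]] : [/\ a = p (inord 0), b = p (inord 1),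
   c = p (inord 2) & d = p (inord 3) /\ e = p (inord 4) /\ f = p (inord 5) /\
   g = p (inord 6)].
  by split; lia.
by [].
Qed.

Theorem theorem2 (p : position) : Ppos p <-> inS p.
Proof.
(* The claims are proved together by induction on the number of tokens: the first two use each other
   one move later, the third uses itself two moves later. *)
suff: [/\ Ppos p -> inS p, Npos p -> ~ inS p & inS p -> Ppos p].
  by case=> *; split.
have [n] := ubnP (tokens p); elim: n p => // n IHn p.
rewrite ltnS => le_pn.
have IH q : move p q -> [/\ Ppos q -> inS q, Npos q -> ~ inS q & inS q -> Ppos q].
  by move=> /move_kept_below [_ _ lt_qp]; apply/IHn/(leq_trans lt_qp).
split.
- move=> [next_N]; have [//|[q pq Sq]] := inS_or_move_inS p.
  by have [_ N_notS _] := IH q pq; case: (N_notS (next_N q pq)).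
- move=> [q pq Pq] Sp; have [P_S _ _] := IH q pq.
  exact: (inS_isolated Sp (P_S Pq) pq).
- move=> Sp; constructor=> q pq; have [Sq|[r qr Sr]] := inS_or_move_inS q.
    by case: (inS_isolated Sp Sq pq).
  apply: (Npos_intro qr).
  have [_ _ lt_qp] := move_kept_below pq; have [_ _ lt_rq] := move_kept_below qr.
  by have [_ _] := IHn r (leq_trans lt_rq (leq_trans (ltnW lt_qp) le_pn)); apply.
Qed.
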